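(* Suppose the functions $d=d(n)\ge 3$ and $0<p=p(n)<1$ satisfy $(\log n)/d-3\log\log n\to\infty$, $p^d n^{d-1}-2\log n\to\infty$ and $p^{d-1}n^{d-2}-2\log n\to-\infty$. Then for any $1\le r\le d-2$, asymptotically almost surely $$(1-o(1))\,n^{1-r}p^{-r}\frac{\log n}{\log(n^{1-r}p^{-r})}\le M(G(n,p),\le r)\le (1+o(1))\,n^{1-r}p^{-r}\ln n.$$
   Context: $G(n,p)$ is the Erdős–Rényi random graph on $n$ labeled vertices with each edge present independently with probability $p$; ''asymptotically almost surely'' means with probability tending to $1$ as $n\to\infty$. For a graph $G$, $M(G,\le r)$ is the minimum size of a family of balls $B(u,s)=\{w:d_G(u,w)\le s\}$ with radii $s\le r$ such that for any two distinct vertices $x,y$ some ball in the family contains exactly one of $x,y$ (equivalently, the minimum number of non-adaptive queries ''is the unknown vertex in $B(u,s)$?'' with $s\le r$ that determine any unknown vertex). $\log$ is base 2 and $\ln$ is the natural logarithm. *)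

(* Defs.v *)
From mathcomp Require Import all_boot all_order all_algebra.
From mathcomp Require Import all_classical all_reals all_analysis.

Set Implicit Arguments.
Unset Strict Implicit.
Unset Printing Implicit Defensive.

Import Order.TTheory GRing.Theory Num.Theory.
Import numFieldNormedType.Exports.

Local Open Scope ring_scope.

Section Distance.
Variables (V : finType) (e : rel V).
Implicit Types (u w : V) (k s r : nat).

Definition walk u w k : bool :=
  [exists t : k.-tuple V, path e u t && (last u t == w)].

Lemma walk_ex u w : connect e u w -> exists k, walk u w k.
Proof.
case/connectP=> t et ->; exists (size t).
by apply/existsP; exists (in_tuple t); rewrite et eqxx.
Qed.

(* [None] stands for an infinite distance. *)
Definition gdist u w : option nat :=
  if @idP (connect e u w) is ReflectT uw then Some (ex_minn (walk_ex uw))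
  else None.

Definition gball u s : {set V} :=
  [set w | if gdist u w is Some k then (k <= s)%N else false].

Lemma in_gballP u s w :
  reflect (exists2 k, (k <= s)%N & walk u w k) (w \in gball u s).
Proof.
rewrite inE /gdist; case: {-}_ / idP => [uw|nuw].
  case: ex_minnP => m uwm minm; apply: (iffP idP) => [ms|[k ks uwk]].
    by exists m.
  exact: leq_trans (minm k uwk) ks.
apply: (iffP idP) => // -[k _ /existsP[t /andP[et /eqP wE]]].
by case: nuw; apply/connectP; exists t.
Qed.

Definition is_ball r (B : {set V}) : bool :=
  [exists u : V, [exists s : 'I_r.+1, B == gball u s]].

Definition separating (F : {set {set V}}) : bool :=
  [forall x : V, forall y : V, (x != y) ==>
    [exists B in F, (x \in B) != (y \in B)]].

Definition identifying_family r (F : {set {set V}}) : bool :=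
  [forall B in F, is_ball r B] && separating F.

(* The balls of radius 0 are the singletons, so a separating family exists. *)
Lemma identifying_family_ex r :
  exists k, [exists F : {set {set V}}, identifying_family r F && (#|F| == k)].
Proof.
pose F := [set gball u 0 | u : V].
have ball0 u w : (w \in gball u 0) = (w == u).
  apply/in_gballP/eqP => [[k]|->].
    rewrite leqn0 => /eqP-> /existsP[t /andP[_ /eqP <-]].
    by rewrite tuple0.
  by exists 0%N => //; apply/existsP; exists [tuple]; rewrite /= eqxx.
exists #|F|; apply/existsP; exists F; rewrite eqxx andbT.
apply/andP; split.
  apply/forallP=> B; apply/implyP => /imsetP[u _ ->].
  by apply/existsP; exists u; apply/existsP; exists ord0.
apply/forallP=> x; apply/forallP=> y; apply/implyP=> xy.
apply/existsP; exists (gball x 0).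
by rewrite imset_f //= !ball0 eqxx [y == x]eq_sym (negbTE xy).
Qed.

Definition Mle r : nat := ex_minn (identifying_family_ex r).

End Distance.

Definition edge (n : nat) := {a : {set 'I_n} | #|a| == 2}.

Definition graph (n : nat) := {set edge n}.

Definition adj (n : nat) (G : graph n) : rel 'I_n :=
  fun x y => [exists a in G, val a == [set x; y]].

Section RandomGraph.
Variable R : realType.

Definition gnp_weight (n : nat) (p : R) (G : graph n) : R :=
  \prod_(a : edge n) (if a \in G then p else 1 - p).

Definition gnp_prob (n : nat) (p : R) (A : pred (graph n)) : R :=
  \sum_(G : graph n | A G) gnp_weight p G.

Lemma gnp_prob_total (n : nat) (p : R) : @gnp_prob n p predT = 1.
Proof.
transitivity (\prod_(a : edge n) (p + (1 - p))); last first.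
  by rewrite big1 // => a _; rewrite addrC subrK.
rewrite bigA_distr /gnp_prob; apply: eq_bigl => G; by rewrite !inE.
Qed.

Definition log2 (x : R) : R := ln x / ln 2.

End RandomGraph.

(* Main.v *)
Require Import Defs.
From mathcomp Require Import all_boot all_order all_algebra.
From mathcomp Require Import all_classical all_reals all_analysis.
From mathcomp Require Import zify ring lra.

Set Implicit Arguments.
Unset Strict Implicit.
Unset Printing Implicit Defensive.

Import Order.TTheory GRing.Theory Num.Theory.
Import numFieldNormedType.Exports.

Local Open Scope ring_scope.

(** Let D = np and Q = n / D^r. The hypotheses give D >> (log n)^3, d <= log n and
    Q >= D / (2 log n), so with delta = sqrt (32 log n / D) the quantity
    kappa = delta log n tends to 0. By Chernoff and union bounds, with
    probability at least 1 - 4/n all degrees are below (1 + delta) D and every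
    nonempty vertex set S with 4 p |S| <= delta has at least (1 - delta) D |S|
    outside neighbours. Both are properties of the graph, from which everything
    else is deterministic: balls of radius r have at most (1 + O(kappa)) D^r
    vertices, and growing {x, y} by expansion shows that the balls around x and y
    have a union of at least 2 (1 - kappa) D^r vertices, hence a symmetric
    difference of at least 2 (1 - O(kappa)) D^r. The upper bound follows by taking
    (1 + o(1)) Q ln n random centers and summing over pairs; the lower bound is an
    entropy estimate, a ball containing a fraction at most (1 + O(kappa)) / Q of
    the vertices. *)

(** * Balls as iterated neighbourhoods *)

Section Balls.
Import fintype boot.finset.
Variables (V : finType) (e : rel V).
Implicit Types (u v w x y : V) (k s r : nat) (S : {set V}).

(** This may meet [S] itself, so the expansion statements speak of [nbrs S :\: S]. *)
Definition nbrs S : {set V} := [set w | [exists v in S, e v w]].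

Lemma nbrsP S w : reflect (exists2 v, v \in S & e v w) (w \in nbrs S).
Proof.
rewrite inE; apply: (iffP existsP) => [[v /andP[vS vw]]|[v vS vw]].
  by exists v.
by exists v; rewrite vS.
Qed.

Lemma nbrsU S1 S2 : nbrs (S1 :|: S2) = nbrs S1 :|: nbrs S2.
Proof.
apply/setP => w; rewrite in_setU; apply/nbrsP/orP => [[v]|].
  by rewrite in_setU => /orP[vS|vS] vw; [left|right]; apply/nbrsP; exists v.
by case=> /nbrsP[v vS vw]; exists v; rewrite // in_setU vS ?orbT.
Qed.

Lemma walk0 u w : walk e u w 0 = (w == u).
Proof.
apply/existsP/eqP => [[t /andP[_ /eqP <-]]|->]; first by rewrite tuple0.
by exists [tuple]; rewrite /= eqxx.
Qed.

Lemma walkS u w k : walk e u w k.+1 = [exists v, walk e u v k && e v w].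
Proof.
apply/existsP/existsP => [[t /andP[]]|[v /andP[/existsP[t /andP[et /eqP tv]] vw]]].
  case: t => s /=; case/lastP: s => // s z; rewrite size_rcons eqSS => sk.
  rewrite rcons_path last_rcons => /andP[es ez] /eqP <-.
  exists (last u s); rewrite ez andbT; apply/existsP.
  by exists (Tuple sk); rewrite /= es eqxx.
by exists [tuple of rcons t w]; rewrite /= rcons_path et tv vw last_rcons eqxx.
Qed.

Lemma gball0 u : gball e u 0 = [set u].
Proof.
apply/setP => w; rewrite in_set1 -walk0.
apply/in_gballP/idP => [[k]|uw]; last by exists 0%N.
by rewrite leqn0 => /eqP ->.
Qed.

Lemma gballS u s : gball e u s.+1 = gball e u s :|: nbrs (gball e u s).
Proof.
apply/setP => w; rewrite in_setU; apply/in_gballP/orP => [[k]|].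
  rewrite leq_eqVlt => /orP[/eqP ->|ks uw]; last first.
    by left; apply/in_gballP; exists k.
  rewrite walkS => /existsP[v /andP[uv vw]]; right; apply/nbrsP; exists v => //.
  by apply/in_gballP; exists s.
case=> [/in_gballP[k ks uw]|/nbrsP[v /in_gballP[k ks uv] vw]].
  by exists k => //; exact: leqW.
by exists k.+1 => //; rewrite walkS; apply/existsP; exists v; rewrite uv.
Qed.

Lemma gball_subset u s t : (s <= t)%N -> gball e u s \subset gball e u t.
Proof.
move=> st; apply/subsetP => w /in_gballP[k ks uw].
by apply/in_gballP; exists k => //; exact: leq_trans st.
Qed.

Hypothesis esym : symmetric e.

Lemma walk_sym u w k : walk e u w k = walk e w u k.
Proof.
suff sub a b : walk e a b k -> walk e b a k by apply/idP/idP; exact: sub.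
case/existsP => t /andP[et /eqP <-]; apply/existsP.
(* The tuple of a walk omits its start, so the reversed one must drop the end and include the start,
   as [belast] does. *)
exists [tuple of rev (belast a t)]; rewrite /= rev_path.
rewrite (eq_path (e' := e)) ?et => [|x y]; last exact: esym.
by case: (val t) => //= x s; rewrite rev_cons last_rcons eqxx.
Qed.

(** Lets a centre whose ball separates [x] from [y] be read as a point of the symmetric difference
    of the balls around [x] and [y]. *)
Lemma gball_sym u w s : (w \in gball e u s) = (u \in gball e w s).
Proof.
by apply/in_gballP/in_gballP => -[k ks]; rewrite walk_sym; exists k.
Qed.

End Balls.

(** * Ball sizes from degree and expansion bounds *)

Section BallSizes.
Import fintype boot.finset.
Variables (R : realType) (V : finType) (e : rel V).
Implicit Types (u v w x y : V) (k s r : nat) (S : {set V}).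

Lemma card_nbrs_le (D : R) S : (forall v, #|nbrs e [set v]|%:R <= D) ->
  #|nbrs e S|%:R <= D * #|S|%:R.
Proof.
move=> degD; have -> : nbrs e S = \bigcup_(v in S) nbrs e [set v].
  apply/setP => w; apply/nbrsP/bigcupP => -[v vS].
    by exists v => //; apply/nbrsP; exists v; rewrite // in_set1.
  by case/nbrsP => v'; rewrite in_set1 => /eqP -> ?; exists v.
have -> : D * #|S|%:R = \sum_(v in S) D by rewrite sumr_const mulr_natr.
apply: (@le_trans _ _ (\sum_(v in S) #|nbrs e [set v]|)%:R); last first.
  by rewrite natr_sum; apply: ler_sum.
rewrite ler_nat; elim/big_rec2: _ => [|v m A _ mA]; first by rewrite cards0.
by rewrite (leq_trans (leq_card_setU _ _)) // leq_add2l.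
Qed.

Lemma card_gball_le (D : R) u s : (forall v, #|nbrs e [set v]|%:R <= D) ->
  #|gball e u s|%:R <= (1 + D) ^+ s.
Proof.
move=> degD; have D0 : 0 <= D by apply: le_trans (degD u).
elim: s => [|s IH]; first by rewrite gball0 cards1.
rewrite gballS exprS (le_trans (y := (#|gball e u s| + #|nbrs e (gball e u s)|)%:R)) //.
  by rewrite ler_nat leq_card_setU.
rewrite natrD (le_trans (lerD (lexx _) (card_nbrs_le _ degD))) //.
by rewrite -[X in X + _]mul1r -mulrDl ler_wpM2l // addr_ge0.
Qed.

(* The two balls are grown simultaneously, as the neighbourhoods of one set
   starting from [set x; y]; hence the factor 2. *)
Lemma card_gballU_ge (D c : R) x y r (s0 : R) : x != y -> 0 <= c ->
    (forall v, #|nbrs e [set v]|%:R <= D) ->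
    2 * (1 + D) ^+ r.-1 <= s0 ->
    (forall S, S != set0 -> #|S|%:R <= s0 ->
       c * #|S|%:R <= #|nbrs e S :\: S|%:R) ->
  2 * c ^+ r <= #|gball e x r :|: gball e y r|%:R.
Proof.
move=> xy c0 degD s0_ge expand.
have D0 : 0 <= D by apply: le_trans (degD x).
have rec s : (s <= r)%N -> 2 * c ^+ s <= #|gball e x s :|: gball e y s|%:R.
  elim: s => [_|s IH sr].
    by rewrite !gball0 cards2 xy mulr1.
  set U := gball e x s :|: gball e y s.
  have -> : gball e x s.+1 :|: gball e y s.+1 = U :|: nbrs e U.
    by rewrite !gballS nbrsU setUACA.
  (* Expansion is applied only to unions of radius [s < r], hence the exponent [r.-1] in the
     hypothesis on [s0]. *)
  have UD : #|U|%:R <= s0.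
    apply: le_trans s0_ge.
    apply: (@le_trans _ _ (#|gball e x s| + #|gball e y s|)%:R).
      by rewrite ler_nat leq_card_setU.
    rewrite natrD mulr_natl mulr2n.
    have Dr : (1 + D) ^+ s <= (1 + D) ^+ r.-1.
      by apply: ler_weXn2l; [rewrite lerDl | case: (r) sr].
    by apply: lerD; apply: le_trans Dr; exact: card_gball_le.
  have U0 : U != set0.
    apply/set0Pn; exists x; rewrite in_setU.
    by rewrite (subsetP (gball_subset e x (leq0n s))) // gball0 set11.
  rewrite exprS mulrCA; apply: (@le_trans _ _ (c * #|U|%:R)).
    by rewrite ler_wpM2l // IH // ltnW.
  apply: le_trans (expand U U0 UD) _; rewrite ler_nat subset_leq_card //.
  by apply: subset_trans (subsetDl _ _) (subsetUr _ _).
exact: rec.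
Qed.

End BallSizes.

(** * Moments and tail bounds in the random graph *)

Section Moments.
Import fintype boot.finset.
Variables (R : realType) (n : nat) (p : R).
Implicit Types (S W A : {set 'I_n}) (G : graph n) (F : {set edge n}).

(** Independence of the edges: multiplying out the product of two-term sums runs through all
    graphs. *)
Lemma gnp_expect_prod (g : edge n -> bool -> R) :
  \sum_(G : graph n) gnp_weight p G * \prod_a g a (a \in G) =
  \prod_a (p * g a true + (1 - p) * g a false).
Proof.
rewrite bigA_distr; apply: eq_bigr => G _; rewrite /gnp_weight -big_split /=.
by apply: eq_bigr => a _; case: ifP.
Qed.

(** The indicator of [F \subset G] is a product with one factor per edge, so its expectation
    factorises. *)
Lemma gnp_prob_sub F : gnp_prob p (fun G => F \subset G) = p ^+ #|F|.
Proof.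
have -> : gnp_prob p (fun G => F \subset G) =
    \sum_(G : graph n) gnp_weight p G *
      \prod_a (if a \in F then (a \in G)%:R else 1).
  rewrite /gnp_prob big_mkcond /=; apply: eq_bigr => G _.
  case: ifP => [FG|/negbT/subsetPn[a aF aG]].
    rewrite big1 ?mulr1 // => a _; case: ifP => // aF.
    by rewrite (subsetP FG).
  by rewrite (bigD1 a) //= aF (negbTE aG) mul0r mulr0.
rewrite (gnp_expect_prod (fun a b => if a \in F then b%:R else 1)).
rewrite -prodr_const [RHS]big_mkcond; apply: eq_bigr => a _.
by case: ifP => _ /=; rewrite ?mulr1n ?mulr0n; ring.
Qed.

Lemma gnp_prob_disj F : gnp_prob p (fun G => [disjoint F & G]) = (1 - p) ^+ #|F|.
Proof.
have -> : gnp_prob p (fun G => [disjoint F & G]) =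
    \sum_(G : graph n) gnp_weight p G *
      \prod_a (if a \in F then (a \notin G)%:R else 1).
  rewrite /gnp_prob big_mkcond /=; apply: eq_bigr => G _.
  case: ifP => [FG|/negbT/pred0Pn[a /andP[aF aG]]].
    rewrite big1 ?mulr1 // => a _; case: ifP => // aF.
    by rewrite (disjointFr FG).
  have {}aF : a \in F by []. have {}aG : a \in G by [].
  by rewrite (bigD1 a) //= aF aG mul0r mulr0.
rewrite (gnp_expect_prod (fun a b => if a \in F then (~~ b)%:R else 1)).
rewrite -prodr_const [RHS]big_mkcond; apply: eq_bigr => a _.
by case: ifP => _ /=; rewrite ?mulr1n ?mulr0n; ring.
Qed.

(** The binomial theorem organised by subsets. It expands the moment generating function and later
    sums a union bound over all vertex sets. *)
Lemma sum_subset_expr (T : finType) (A : {set T}) (a : R) :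
  \sum_(W : {set T} | W \subset A) a ^+ #|W| = (1 + a) ^+ #|A|.
Proof.
rewrite -prodr_const [RHS]big_mkcond /=.
transitivity (\prod_i ((if i \in A then a else 0) + 1)); last first.
  by apply: eq_bigr => i _; case: ifP => _; ring.
rewrite bigA_distr big_mkcond; apply: eq_bigr => W _.
rewrite -big_mkcond /=; case: ifP => [WA|/negbT/subsetPn[i iW iA]].
  by rewrite -prodr_const; apply: eq_bigr => i iW; rewrite (subsetP WA).
by rewrite (bigD1 i) //= (negbTE iA) mul0r.
Qed.

(* The binomial moment generating function, from inclusion probabilities only:
   no independence of the events [x \in T G] has to be formulated. *)
Lemma gnp_mgf (T : graph n -> {set 'I_n}) A (q a : R) :
    (forall G, T G \subset A) ->
    (forall W, W \subset A -> gnp_prob p (fun G => W \subset T G) = q ^+ #|W|) ->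
  \sum_(G : graph n) gnp_weight p G * (1 + a) ^+ #|T G| = (1 + a * q) ^+ #|A|.
Proof.
move=> TA PT; rewrite -sum_subset_expr.
(* Expanding over the subsets [W] of [T G] and exchanging the sums leaves only the inclusion
   probabilities of [W]. *)
under eq_bigr => G _ do rewrite -sum_subset_expr big_distrr /= big_mkcond.
rewrite exchange_big /= [RHS]big_mkcond /=; apply: eq_bigr => W _.
case: ifP => WA; last first.
  rewrite big1 // => G _; case: ifP => // WT.
  by rewrite (subset_trans WT (TA G)) in WA.
rewrite exprMn -(PT _ WA) /gnp_prob mulrC big_distrl /= [RHS]big_mkcond /=.
by apply: eq_bigr => G _.
Qed.

Hypothesis p01 : 0 <= p <= 1.

Lemma gnp_weight_ge0 G : 0 <= gnp_weight p G.
Proof.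
case/andP: p01 => p0 p1; apply: prodr_ge0 => a _.
by case: ifP; rewrite // subr_ge0.
Qed.

(** Markov's inequality, with [f] as a majorant of the indicator. *)
Lemma gnp_prob_le_expect (P : pred (graph n)) (f : graph n -> R) :
    (forall G, 0 <= f G) -> (forall G, P G -> 1 <= f G) ->
  gnp_prob p P <= \sum_(G : graph n) gnp_weight p G * f G.
Proof.
move=> f0 f1; rewrite /gnp_prob big_mkcond /=; apply: ler_sum => G _.
case: ifP => PG; last by rewrite mulr_ge0 // gnp_weight_ge0.
by rewrite ler_peMr ?gnp_weight_ge0 ?f1.
Qed.

Lemma gnp_prob_mono (P P' : pred (graph n)) : (forall G, P G -> P' G) ->
  gnp_prob p P <= gnp_prob p P'.
Proof.
move=> PP'; rewrite /gnp_prob big_mkcond [leRHS]big_mkcond /=.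
apply: ler_sum => G _; case: ifP => [/PP' -> //|_].
by case: ifP => // _; exact: gnp_weight_ge0.
Qed.

Lemma gnp_probC (P : pred (graph n)) :
  gnp_prob p P = 1 - gnp_prob p (fun G => ~~ P G).
Proof.
by rewrite -(gnp_prob_total n p) [X in X - _](bigID P) addrK.
Qed.

Lemma gnp_prob_le1 (P : pred (graph n)) : gnp_prob p P <= 1.
Proof. by rewrite -(gnp_prob_total n p); exact: gnp_prob_mono. Qed.

Lemma gnp_prob_or (P P' : pred (graph n)) :
  gnp_prob p (fun G => P G || P' G) <= gnp_prob p P + gnp_prob p P'.
Proof.
rewrite /gnp_prob big_mkcond [X in X + _]big_mkcond [X in _ + X]big_mkcond /=.
rewrite -big_split /=; apply: ler_sum => G _.
have := gnp_weight_ge0 G.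
by case: (P G); case: (P' G) => /= ?; rewrite ?addr0 ?add0r // lerDl.
Qed.

Lemma gnp_prob_exists (I : finType) (P : I -> pred (graph n)) :
  gnp_prob p (fun G => [exists i, P i G]) <= \sum_i gnp_prob p (P i).
Proof.
apply: (@le_trans _ _ (\sum_(G : graph n) gnp_weight p G * \sum_i (P i G)%:R)).
  apply: gnp_prob_le_expect => G; first by apply: sumr_ge0.
  case/existsP => i Pi; rewrite (bigD1 i) //= Pi lerDl.
  exact: sumr_ge0.
under eq_bigr => G _ do rewrite big_distrr /=.
rewrite exchange_big /=; apply: ler_sum => i _.
rewrite /gnp_prob [leRHS]big_mkcond /=; apply: ler_sum => G _.
by case: (P i G); rewrite ?mulr1 ?mulr0.
Qed.

(** Markov's inequality for the exponential of [t] times [#|T G| - z]; its mean comes from [gnp_mgf]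
    with [1 + a = expR t]. *)
Lemma gnp_chernoff (T : graph n -> {set 'I_n}) A (q t z : R) :
    0 <= q -> 0 <= t ->
    (forall G, T G \subset A) ->
    (forall W, W \subset A -> gnp_prob p (fun G => W \subset T G) = q ^+ #|W|) ->
  gnp_prob p (fun G => z <= #|T G|%:R) <=
    expR (- (t * z)) * (1 + (expR t - 1) * q) ^+ #|A|.
Proof.
move=> q0 t0 TA PT; rewrite -(gnp_mgf _ TA PT) big_distrr /=.
under eq_bigr => G _ do rewrite mulrCA.
apply: gnp_prob_le_expect => G.
  by rewrite mulr_ge0 ?expR_ge0 // exprn_ge0 // subrKC expR_ge0.
move=> zT; rewrite subrKC -expRM_natl -expRD -[leLHS]expR0 ler_expR.
by rewrite -mulr_natl mulrC; have := ler_wpM2l t0 zT; lra.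
Qed.

End Moments.

(** * Edges between two disjoint vertex sets *)

Section Edges.
Import fintype boot.finset.
Variable n : nat.
Implicit Types (S W : {set 'I_n}) (x y v w : 'I_n) (G : graph n).

Lemma adj_sym G : symmetric (adj G).
Proof. by move=> x y; rewrite /adj; under eq_existsb => a do rewrite setUC. Qed.

Lemma adj_irr G x : adj G x x = false.
Proof.
apply/negbTE/existsPn => a; rewrite negb_and; apply/orP; right.
apply/eqP => ax; have := valP a.
by rewrite ax setUid cards1.
Qed.

Definition edges_between S W : {set edge n} :=
  [set a | [exists x in S, exists y in W, val a == [set x; y]]].

Lemma mkedge x y : x != y -> {a : edge n | val a = [set x; y]}.
Proof.
move=> xy; have xy2 : #|[set x; y]| == 2%N by rewrite cards2 xy.
by exists (exist (fun a : {set 'I_n} => #|a| == 2%N) _ xy2).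
Qed.

Lemma edges_betweenP S W (a : edge n) :
  reflect (exists x y, [/\ x \in S, y \in W & val a = [set x; y]])
          (a \in edges_between S W).
Proof.
rewrite inE; apply: (iffP existsP) => [[x /andP[xS /existsP[y /andP[yW /eqP]]]]|].
  by exists x, y.
case=> x [y [xS yW axy]]; exists x; rewrite xS; apply/existsP; exists y.
by rewrite yW axy /=.
Qed.

(** The map from [(x, y)] to [[set x; y]] is injective on [setX S W], because disjointness tells
    which endpoint lies in [S]. *)
Lemma card_edges_between S W : [disjoint S & W] ->
  #|edges_between S W| = (#|S| * #|W|)%N.
Proof.
move=> dSW; rewrite -cardsX -(card_imset _ val_inj).
pose f (u : 'I_n * 'I_n) : {set 'I_n} := [set u.1; u.2].
have -> : val @: edges_between S W = f @: setX S W.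
  apply/setP => B; apply/imsetP/imsetP => [[a]|[[x y]]].
    by move=> /edges_betweenP[x [y [xS yW axy]]] ->; exists (x, y); rewrite ?in_setX ?xS.
  rewrite in_setX /f /= => /andP[xS yW] ->.
  have xy : x != y by apply: contraTneq xS => ->; rewrite (disjointFl dSW).
  by have [a axy] := mkedge xy; exists a => //; apply/edges_betweenP; exists x, y.
rewrite card_in_imset // => -[x y] [x' y']; rewrite !in_setX /f /=.
move=> /andP[xS yW] /andP[xS' yW'] E.
have : x \in [set x'; y'] by rewrite -E set21.
rewrite !inE => /orP[/eqP xx'|/eqP xy']; last first.
  by rewrite xy' (disjointFl dSW) in xS.
have : y \in [set x'; y'] by rewrite -E set22.
rewrite !inE => /orP[/eqP yx'|/eqP -> //]; last by rewrite xx'.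
by rewrite -yx' (disjointFl dSW) in xS'.
Qed.

Lemma edges_between_sub S W G : [disjoint S & W] ->
  (edges_between S W \subset G) = [forall x in S, forall y in W, adj G x y].
Proof.
move=> dSW; apply/subsetP/forall_inP => [EG x xS|adjSW a].
  apply/forall_inP => y yW.
  have xy : x != y by apply: contraTneq xS => ->; rewrite (disjointFl dSW).
  have [a axy] := mkedge xy; apply/existsP; exists a; rewrite axy eqxx andbT.
  by apply: EG; apply/edges_betweenP; exists x, y.
case/edges_betweenP => x [y [xS yW axy]].
have /forall_inP/(_ y yW)/existsP[b /andP[bG /eqP bxy]] := adjSW x xS.
by rewrite (_ : a = b) //; apply: val_inj; rewrite axy bxy.
Qed.

(** With [gnp_prob_disj], this yields the probability that no vertex of [W] is a neighbour of
    [S]. *)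
Lemma edges_between_disj S W G : [disjoint S & W] ->
  [disjoint edges_between S W & G] = (W \subset ~: nbrs (adj G) S).
Proof.
move=> dSW; apply/pred0P/subsetP => [EG y yW|WN a].
  rewrite in_setC; apply/negP => /nbrsP[x xS /existsP[a /andP[aG /eqP axy]]].
  have /negP := EG a; apply; apply/andP; split => //.
  by apply/edges_betweenP; exists x, y.
apply/negP => /andP[/= /edges_betweenP[x [y [xS yW axy]]] aG].
have := WN y yW; rewrite in_setC => /negP; apply; apply/nbrsP; exists x => //.
by apply/existsP; exists a; rewrite axy eqxx andbT.
Qed.

End Edges.

(** * Entropy and first-moment bounds on identifying families *)

Section Identification.
Import fintype boot.finset.
Variables (R : realType) (V : finType) (e : rel V).
Implicit Types (u v w x y : V) (k s r m : nat) (F : {set {set V}}).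

Lemma Mle_le_card r F : identifying_family e r F -> (Mle e r <= #|F|)%N.
Proof.
move=> idF; rewrite /Mle; case: ex_minnP => k _; apply.
by apply/existsP; exists F; rewrite idF eqxx.
Qed.

Lemma Mle_family r : exists2 F, identifying_family e r F & #|F| = Mle e r.
Proof.
rewrite /Mle; case: ex_minnP => k /existsP[F /andP[idF /eqP Fk]] _.
by exists F.
Qed.

(* Codewords of an injective code, read under the product measure in which
   each bit is 1 with probability q, have total mass at most 1. *)
Lemma separating_kraft F (q : R) : separating F -> 0 <= q <= 1 ->
  \sum_(x : V) \prod_(B in F) (if x \in B then q else 1 - q) <= 1.
Proof.
move=> /forallP sepF /andP[q0 q1].
have {q1}q1 : 0 <= 1 - q by rewrite subr_ge0.
(* A set outside [F] gets bit 0 with probability 1, so [h] is a product measure on all families,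
   carried by the subfamilies of [F]. *)
pose h (T : {set {set V}}) := \prod_B (if B \in T then (if B \in F then q else 0)
                                       else (if B \in F then 1 - q else 1)) : R.
have h0 T : 0 <= h T by apply: prodr_ge0 => B _; do 2 case: ifP => _.
have hsum : \sum_T h T = 1.
  rewrite -bigA_distr big1 // => B _.
  by case: (B \in F) => /=; ring.
pose code x := [set B in F | x \in B].
have code_inj : injective code.
  move=> x y xy; apply/eqP; apply: contraT => nxy.
  have /forallP/(_ y)/implyP/(_ nxy)/existsP[B /andP[BF /negP[]]] := sepF x.
  by have /setP/(_ B) := xy; rewrite !inE BF /= => ->.
rewrite -[leRHS]hsum; apply: (@le_trans _ _ (\sum_(T in code @: V) h T)); last first.
  by rewrite [leRHS](bigID (mem (code @: V))) /= lerDl sumr_ge0.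
rewrite big_imset /=; last by move=> x y _ _; exact: code_inj.
rewrite le_eqVlt; apply/orP; left; apply/eqP; apply: eq_big => // x _.
rewrite [LHS]big_mkcond /=; apply: eq_bigr => B _; rewrite inE.
by case: (B \in F); case: (x \in B).
Qed.

(** Kraft's inequality and convexity of the exponential bound [ln #|V|] by the mean of minus the
    log-weight of a codeword, to which each ball contributes at most the bracketed factor. *)
Lemma Mle_ge r (b q : R) : (0 < #|V|)%N -> 0 < q < 1 ->
    (forall u s, (s <= r)%N -> #|gball e u s|%:R <= b) ->
  ln #|V|%:R <= (Mle e r)%:R * (b / #|V|%:R * - ln q - ln (1 - q)).
Proof.
move=> V0 /andP[q0 q1] ballb.
have [F /andP[/forall_inP ballF sepF] <-] := Mle_family r.
set N : R := #|V|%:R; have N0 : 0 < N by rewrite ltr0n.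
have q1' : 0 < 1 - q by rewrite subr_gt0.
have lnq : ln q <= 0 by rewrite ln_le0 // ltW.
have lnq' : ln (1 - q) <= 0 by rewrite ln_le0 // gerBl ltW.
pose y x := \sum_(B in F) (if x \in B then ln q else ln (1 - q)) : R.
have ey x : expR (y x) = \prod_(B in F) (if x \in B then q else 1 - q).
  by rewrite expR_sum; apply: eq_bigr => B _; case: ifP => _; rewrite lnK ?posrE.
have kraft : \sum_x expR (y x) <= 1.
  under eq_bigr => x _ do rewrite ey.
  by apply: separating_kraft => //; rewrite !ltW.
set Y := \sum_x y x.
(* The tangent of the exponential at the mean [Y / N] lies below its graph, and the linear terms
   cancel in the sum over [x]. *)
have jensen : N * expR (Y / N) <= 1.
  apply: le_trans kraft.
  have -> : N * expR (Y / N) = \sum_x expR (Y / N) * (1 + (y x - Y / N)).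
    rewrite -big_distrr /= mulrC big_split /= sumrB !sumr_const -/Y.
    rewrite -[Y / N *+ _]mulr_natr -/N divfK ?gt_eqF // subrr addr0.
    by [].
  apply: ler_sum => x _; rewrite -[in leRHS](subrKC (Y / N) (y x)) expRD.
  by rewrite ler_wpM2l ?expR_ge0 // expR_ge1Dx.
have Yge : #|F|%:R * (b * ln q + N * ln (1 - q)) <= Y.
  rewrite /Y exchange_big /= mulr_natl -sumr_const; apply: ler_sum => B BF.
  (* Charging [ln (1 - q)] to the members of [B] as well only lowers the sum, since this logarithm
     is nonpositive. *)
  apply: (@le_trans _ _ (\sum_x ((x \in B)%:R * ln q + ln (1 - q)))).
    rewrite big_split /= sumr_const -big_distrl /= -natr_sum.
    have -> : (\sum_x (x \in B : nat) = #|B|)%N.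
      by rewrite -sum1_card [RHS]big_mkcond; apply: eq_bigr => x _; case: ifP.
    rewrite -/N -[ln (1 - q) *+ _]mulr_natl -/N lerD2r ler_wnM2r //.
    have /existsP[u /existsP[s /eqP ->]] := ballF B BF.
    by rewrite ballb // -ltnS.
  by apply: ler_sum => x _; case: ifP => _; rewrite ?mul1r ?mul0r ?add0r ?gerDl.
have lnN : ln N <= - (Y / N).
  rewrite -(expRK (- (Y / N))) ler_ln ?posrE ?expR_gt0 //.
  by rewrite expRN -[leRHS]mul1r ler_pdivlMr ?expR_gt0.
apply: le_trans lnN _.
rewrite lerNl.
have -> : - (#|F|%:R * (b / N * - ln q - ln (1 - q))) =
   (#|F|%:R * (b * ln q + N * ln (1 - q))) / N.
  by field; rewrite gt_eqF.
by rewrite ler_pM2r ?invr_gt0.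
Qed.

(* First moment over m uniformly random centers: the expected number of
   ordered pairs left unseparated is below 1. *)
Lemma Mle_le r m (beta : R) : symmetric e -> (0 < #|V|)%N ->
    (forall x y, x != y ->
       beta <= #|[set u | (u \in gball e x r) != (u \in gball e y r)]|%:R) ->
    #|V|%:R ^+ 2 * expR (- (m%:R * beta / #|V|%:R)) <= 1 ->
  (Mle e r <= m)%N.
Proof.
move=> esym V0 symdiff small.
set N : R := #|V|%:R; have N0 : 0 < N by rewrite ltr0n.
pose D x y := [set u | (u \in gball e x r) != (u \in gball e y r)].
pose bad (c : {ffun 'I_m -> V}) (xy : V * V) := [forall i, c i \notin D xy.1 xy.2].
have badP x y : x != y ->
    #|[set c | bad c (x, y)]|%:R <= N ^+ m * expR (- (m%:R * beta / N)).
  move=> xy.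
  (* The centres avoid [D x y] independently, each in at most [N - beta] of [N] ways. *)
  have -> : #|[set c | bad c (x, y)]| = (#|~: D x y| ^ m)%N.
    rewrite -[in RHS](card_ord m) -card_ffun_on; apply: eq_card => c.
    rewrite inE; apply/forallP/ffun_onP => /= H i; have := H i;
      by rewrite in_setC.
  have -> : - (m%:R * beta / N) = m%:R * - (beta / N) by ring.
  rewrite natrX expRM_natl -exprMn lerXn2r ?nnegrE //.
    by rewrite mulr_ge0 ?expR_ge0 // ltW.
  have CD : #|~: D x y|%:R = N - #|D x y|%:R.
    by rewrite /N -(cardsC (D x y)) natrD addrAC subrr add0r.
  rewrite CD; apply: (@le_trans _ _ (N * (1 + - (beta / N)))).
    by rewrite mulrDr mulr1 mulrN mulrCA divff ?gt_eqF // mulr1 lerB // symdiff.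
  by rewrite ler_wpM2l ?expR_ge1Dx // ltW.
have [c /forallP good] : exists c, [forall xy, (xy.1 != xy.2) ==> ~~ bad c xy].
  apply/existsP; apply: contraT => /existsPn none.
  have cardT : (#|{ffun 'I_m -> V}|%:R : R) = N ^+ m.
    by rewrite card_ffun card_ord natrX.
  have le1 : N ^+ m <= \sum_(xy : V * V | xy.1 != xy.2)
                          (#|[set c | bad c xy]|%:R : R).
    rewrite -cardT -sum1_card !natr_sum.
    under [leRHS]eq_bigr => xy _ do rewrite -sum1_card natr_sum big_mkcond.
    rewrite exchange_big /=; apply: ler_sum => c _.
    have /forallPn[xy] := none c; rewrite negb_imply negbK => /andP[nxy badxy].
    rewrite (bigD1 xy) //= inE badxy lerDl.
    by apply: sumr_ge0 => xy' _; case: ifP.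
  set t := expR _ in small badP.
  have le2 : \sum_(xy : V * V | xy.1 != xy.2) (#|[set c | bad c xy]|%:R : R)
      <= #|[pred xy : V * V | xy.1 != xy.2]|%:R * (N ^+ m * t).
    rewrite mulr_natl -sumr_const; apply: ler_sum => -[x y] /= xy.
    exact: badP.
  (* Diagonal pairs are excluded; the strictness gained here allows the non-strict bound [small]. *)
  have lt3 : (#|[pred xy : V * V | xy.1 != xy.2]|%:R : R) < N ^+ 2.
    rewrite expr2 -natrM -card_prod ltr_nat.
    apply: proper_card; apply/properP; split; first exact/subsetP.
    by have [x0 _] := card_gt0P V0; exists (x0, x0); rewrite // inE /= eqxx.
  have : N ^+ m < N ^+ m.
    apply: le_lt_trans (le_trans le1 le2) _.
    apply: (@lt_le_trans _ _ (N ^+ 2 * (N ^+ m * t))).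
      by rewrite ltr_pM2r // mulr_gt0 ?exprn_gt0 ?expR_gt0.
    by rewrite mulrCA ger_pMr // exprn_gt0.
  by rewrite ltxx.
apply: (@leq_trans #|[set gball e (c i) r | i : 'I_m]|); last first.
  by rewrite (leq_trans (leq_imset_card _ _)) // card_ord.
apply: Mle_le_card; apply/andP; split.
  apply/forall_inP => B /imsetP[i _ ->].
  by apply/existsP; exists (c i); apply/existsP; exists ord_max.
apply/forallP => x; apply/forallP => y; apply/implyP => xy.
have /implyP/(_ xy)/forallPn[i] := good (x, y).
rewrite negbK inE /= => ci; apply/existsP; exists (gball e (c i) r).
by rewrite imset_f //= ![_ \in gball e (c i) r]gball_sym.
Qed.

End Identification.

(** * Elementary exponential inequalities *)

Section ExpBounds.
Variable R : realType.
Implicit Types (t x : R).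

(** From [1 - t <= expR (- t)]: [expR t] is at most [1 / (1 - t)], which is at most [1 + t + 2 t^2]
    for [t] up to 1/2. *)
Lemma expR_le_quadratic t : 0 <= t <= 2^-1 -> expR t - 1 <= t + 2 * t ^+ 2.
Proof.
move=> /andP[t0 t1]; have := expR_ge1Dx (- t); have := expR_gt0 t.
have : expR t * expR (- t) = 1 by rewrite -expRD subrr expR0.
move: (expR t) (expR (- t)) => a b ab a0 bt.
have {ab bt} at1 : a * (1 - t) <= 1 by rewrite -[leRHS]ab ler_wpM2l // ltW.
have t_lt1 : 0 < 1 - t by lra.
rewrite lerBlDr -(ler_pM2r t_lt1); apply: le_trans at1 _.
have -> : (t + 2 * t ^+ 2 + 1) * (1 - t) = 1 + t ^+ 2 * (1 - 2 * t) by ring.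
rewrite lerDl mulr_ge0 ?sqr_ge0 //; lra.
Qed.

(** From [1 + t <= expR t]: [expR (- t)] is at most [1 / (1 + t)], hence at most [1 - t + t^2]. *)
Lemma one_sub_expRN_ge t : 0 <= t -> t - t ^+ 2 <= 1 - expR (- t).
Proof.
move=> t0; have := expR_ge1Dx t; have := expR_gt0 (- t).
have : expR t * expR (- t) = 1 by rewrite -expRD subrr expR0.
move: (expR t) (expR (- t)) => a b ab b0 bt.
have {ab bt} tb1 : (1 + t) * b <= 1 by rewrite -[leRHS]ab ler_wpM2r // ltW.
have t1 : 0 < 1 + t by lra.
suff : b <= 1 - t + t ^+ 2 by lra.
rewrite -(ler_pM2l t1); apply: le_trans tb1 _.
have -> : (1 + t) * (1 - t + t ^+ 2) = 1 + t ^+ 3 by ring.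
by rewrite lerDl exprn_ge0.
Qed.

Lemma expr_one_add_le x k : -1 <= x -> (1 + x) ^+ k <= expR (k%:R * x).
Proof.
move=> x1; rewrite expRM_natl lerXn2r ?nnegrE ?expR_ge0 ?expR_ge1Dx //.
by lra.
Qed.

Lemma bernoulli_sub x k : 0 <= x <= 1 -> 1 - k%:R * x <= (1 - x) ^+ k.
Proof.
move=> /andP[x0 x1]; have x1' : 0 <= 1 - x by rewrite subr_ge0.
elim: k => [|k IH]; first by rewrite mul0r subr0 expr0.
rewrite exprS; apply: le_trans (ler_wpM2l x1' IH).
have : 0 <= k%:R * x * x by rewrite !mulr_ge0.
by rewrite -natr1; lra.
Qed.

End ExpBounds.

(** * Degrees and vertex expansion in the random graph *)

Section Tails.
Import fintype boot.finset.
Variables (R : realType) (n : nat) (p : R).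
Hypothesis p01 : 0 <= p <= 1.
Implicit Types (S W : {set 'I_n}) (v : 'I_n) (G : graph n).
Let D := n%:R * p.

(** Chernoff at [t = delta / 4]: the exponent is at most
    [- t delta D + 2 t^2 D = - D delta^2 / 8]. *)
Lemma degree_tail v (delta : R) : 0 <= delta <= 1 ->
  gnp_prob p (fun G => (1 + delta) * D <= #|nbrs (adj G) [set v]|%:R)
    <= expR (- (D * delta ^+ 2 / 8)).
Proof.
move=> /andP[d0 d1]; have /andP[p0 p1] := p01; pose t := delta / 4.
have t0 : 0 <= t by rewrite divr_ge0.
have sub G : nbrs (adj G) [set v] \subset ~: [set v].
  apply/subsetP => w /nbrsP[x]; rewrite in_set1 => /eqP -> vw.
  by rewrite in_setC1; apply: contraTneq vw => ->; rewrite adj_irr.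
have incl W : W \subset ~: [set v] ->
    gnp_prob p (fun G => W \subset nbrs (adj G) [set v]) = p ^+ #|W|.
  move=> WA; have dW : [disjoint [set v] & W].
    by rewrite disjoint_sym disjoints_subset.
  rewrite -[#|W|]mul1n -(cards1 v) -card_edges_between // -gnp_prob_sub.
  apply: eq_bigl => G; rewrite edges_between_sub //.
  apply/subsetP/forall_inP => [WN x|vW w wW].
    rewrite in_set1 => /eqP ->; apply/forall_inP => w /WN /nbrsP[x'].
    by rewrite in_set1 => /eqP ->.
  apply/nbrsP; exists v; rewrite ?in_set1 //.
  by have /forall_inP := vW v (set11 v); apply.

apply: le_trans (gnp_chernoff p01 _ p0 t0 sub incl) _.
have et1 : 0 <= expR t - 1 by rewrite subr_ge0 -[leLHS]expR0 ler_expR.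
have et2 : expR t - 1 <= t + 2 * t ^+ 2.
  by apply: expR_le_quadratic; rewrite t0 /= /t; lra.

apply: le_trans (ler_wpM2l (expR_ge0 _) (expr_one_add_le _ _)) _.
  by rewrite (le_trans (lerN10 R)) // mulr_ge0.
rewrite -expRD ler_expR.
have D0 : 0 <= D by rewrite mulr_ge0.
have : #|~: [set v]|%:R * ((expR t - 1) * p) <= D * (t + 2 * t ^+ 2).
  have cn : #|~: [set v]|%:R * p <= D.
    by rewrite /D ler_wpM2r // ler_nat -[leqRHS]card_ord max_card.
  by rewrite [(expR t - 1) * p]mulrC mulrA ler_pM // mulr_ge0.
by rewrite /t; lra.
Qed.

(** Poor expansion means that the set [T G] of outside vertices missed by [S] is large, so an upper
    tail suffices. Each outside vertex is missed with probability [q], and smallness of [p s] keeps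
    [1 - q] close to [p s]. *)
Lemma expansion_tail S (delta : R) : 0 <= delta <= 1 ->
    1 <= D -> 4 * (p * #|S|%:R) <= delta ->
  gnp_prob p (fun G => #|nbrs (adj G) S :\: S|%:R < (1 - delta) * D * #|S|%:R)
    <= expR (- (D * delta ^+ 2 / 16)) ^+ #|S|.
Proof.
move=> /andP[d0 d1] D1 psd; have /andP[p0 p1] := p01; pose t := delta / 4.
have t0 : 0 <= t by rewrite divr_ge0.
set s := #|S| in psd *; pose q := (1 - p) ^+ s.
pose T G := ~: S :\: nbrs (adj G) S.
have sub G : T G \subset ~: S by exact: subsetDl.
have incl W : W \subset ~: S -> gnp_prob p (fun G => W \subset T G) = q ^+ #|W|.
  move=> WA; have dW : [disjoint S & W] by rewrite disjoint_sym disjoints_subset.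
  rewrite /q -exprM -card_edges_between // -gnp_prob_disj.
  apply: eq_bigl => G; rewrite edges_between_disj // /T setDE subsetI WA /=.
  by [].
have q0 : 0 <= q by rewrite exprn_ge0 // subr_ge0.
have cardT G : #|T G|%:R + #|nbrs (adj G) S :\: S|%:R = #|~: S|%:R :> R.
  rewrite -natrD; congr (_%:R).
  rewrite -(cardsID (nbrs (adj G) S) (~: S)) addnC; congr addn.
  by rewrite setIC setDE.
pose z : R := #|~: S|%:R - (1 - delta) * D * s%:R.
apply: (@le_trans _ _ (gnp_prob p (fun G => z <= #|T G|%:R))).
  by apply: gnp_prob_mono => // G; rewrite /z => ?; have := cardT G; lra.
apply: le_trans (gnp_chernoff p01 _ q0 t0 sub incl) _.
pose c := (1 - expR (- t)) * (1 - q).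
have ps0 : 0 <= p * s%:R by rewrite mulr_ge0.
have et : t - t ^+ 2 <= 1 - expR (- t) by exact: one_sub_expRN_ge.
have q1 : p * s%:R - (p * s%:R) ^+ 2 <= 1 - q.
  apply: le_trans (one_sub_expRN_ge ps0) _; rewrite lerB // /q.
  have := @expr_one_add_le R (- p) s; rewrite lerN2 p1 => /(_ isT).
  by rewrite [s%:R * _]mulrN [_ * p]mulrC.
(* Factoring out [expR t] cancels the summand [#|~: S|] of [z]; what remains depends on [1 - q], the
   probability of being reached. *)
have base : 1 + (expR t - 1) * q = expR t * (1 - c).
  have : expR t * expR (- t) = 1 by rewrite -expRD subrr expR0.
  by rewrite /c; move: (expR t) (expR (- t)) => a b ab; ring: ab.
have c1 : c <= 1.
  have et0 := expR_gt0 (- t).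
  have qle1 : q <= 1 by rewrite /q exprn_ile1 // ?subr_ge0 // gerBl.
  have e1 : expR (- t) <= 1 by rewrite -[leRHS]expR0 ler_expR oppr_le0.
  by rewrite /c; nra.
rewrite base exprMn mulrA -[expR t ^+ _]expRM_natl -expRD.

apply: le_trans (ler_wpM2l (expR_ge0 _) (expr_one_add_le _ _)) _.
  by rewrite lerN2.
rewrite -expRD -[leRHS]expRM_natl ler_expR.
set A : R := #|~: S|%:R; set y := p * s%:R in psd ps0 q1.
have nA : n%:R = A + s%:R.
  by rewrite /A /s -natrD addnC cardsC card_ord.
have D0 : 0 <= D by lra.
have s0 : 0 <= s%:R :> R by [].
have sD : s%:R <= n%:R * y.
  by rewrite /y mulrA -/D ler_peMl.
(* There are two losses, the square in [q1] and the [s] vertices missing from [A]. Each costs at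
   most [D s y], and [4 y <= delta]. *)
have cA : D * s%:R * (1 - delta / 2) <= (1 - q) * A.
  have sn : s%:R <= n%:R :> R by rewrite nA lerDr.
  have y1 : y <= 1 by lra.
  have A0 : 0 <= A by [].
  apply: le_trans (ler_wpM2r A0 q1).
  have -> : A = n%:R - s%:R by rewrite nA addrK.
  have -> : (y - y ^+ 2) * (n%:R - s%:R) =
      D * s%:R * (1 - y) - y * (1 - y) * s%:R by rewrite /D /y; ring.
  have : y * (1 - y) * s%:R <= D * s%:R * y.
    apply: (@le_trans _ _ (y * s%:R)).
      by rewrite -mulrA ler_wpM2l // ler_piMl // gerBl.
    by have := ler_wpM2r (mulr_ge0 s0 ps0) D1; lra.
  have : D * s%:R * (2 * y) <= D * s%:R * (delta / 2).
    by rewrite ler_wpM2l ?mulr_ge0 //; lra.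
  lra.
have tA : D * s%:R * (1 - delta / 2) * (t - t ^+ 2) <= c * A.
  have tt : 0 <= t - t ^+ 2 by rewrite expr2 subr_ge0 ler_piMl // /t; lra.
  rewrite [leLHS]mulrC -[leRHS]mulrA; apply: ler_pM => //.
  by rewrite !mulr_ge0 // subr_ge0; lra.
(* With [t = delta / 4] the exponent is at most [- D s (delta^2 / 16 + delta^3 / 32)]. *)
rewrite /z -/A -/s; rewrite /t in tA |- *.
have Ds : 0 <= D * s%:R * delta ^+ 2 by rewrite !mulr_ge0.
have Dsd : 0 <= D * s%:R * delta ^+ 2 * delta by rewrite !mulr_ge0.
lra.
Qed.

(** Union bounds with [a <= n^-2]: the degrees fail with probability at most [n a <= 1 / n].
    Expansion fails with at most the sum of [a^|S|] over nonempty [S], which is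
    [(1 + a)^n - 1 <= 1 / n + 2 / n^2]. *)
Lemma degree_expansion_whp (delta : R) : (2 <= n)%N -> 0 <= delta <= 1 ->
    1 <= D -> 2 * ln n%:R <= D * delta ^+ 2 / 16 ->
  1 - 4 / n%:R <=
  gnp_prob p (fun G =>
    [forall v : 'I_n, #|nbrs (adj G) [set v]|%:R < (1 + delta) * D] &&
    [forall S : {set 'I_n}, (S != set0) ==>
       (4 * (p * #|S|%:R) <= delta) ==>
       ((1 - delta) * D * #|S|%:R <= #|nbrs (adj G) S :\: S|%:R)]).
Proof.
move=> n2 d01 D1 dbig.
rewrite gnp_probC lerD2l lerN2.
pose B1 v G := (1 + delta) * D <= #|nbrs (adj G) [set v]|%:R.
pose B2 S G := [&& S != set0, 4 * (p * #|S|%:R) <= delta &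
  #|nbrs (adj G) S :\: S|%:R < (1 - delta) * D * #|S|%:R].
apply: (@le_trans _ _ (gnp_prob p (fun G => [exists v, B1 v G] || [exists S, B2 S G]))).
  apply: gnp_prob_mono => // G; rewrite negb_and !negb_forall.
  case/orP => /existsP[x Hx]; apply/orP; [left|right]; apply/existsP; exists x.
    by rewrite /B1 leNgt.
  by move: Hx; rewrite !negb_imply -ltNge.
have n0 : 0 < n%:R :> R by rewrite ltr0n (leq_trans _ n2).
pose a : R := expR (- (D * delta ^+ 2 / 16)).
have an : a <= (n%:R ^+ 2)^-1.
  rewrite -[X in X^-1]lnK ?posrE ?exprn_gt0 // -expRN ler_expR lerN2.
  by rewrite lnXn // mulr2n; move: dbig; lra.
have a0 : 0 < a by exact: expR_gt0.
apply: le_trans (gnp_prob_or p01 _ _) _.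
apply: (@le_trans _ _ (n%:R * a + ((1 + a) ^+ n - 1))).
  apply: lerD.
    apply: le_trans (gnp_prob_exists p01 _) _.
    rewrite -[n in leRHS]card_ord mulr_natl -sumr_const; apply: ler_sum => v _.
    apply: le_trans (degree_tail v d01) _; rewrite ler_expR lerN2.
    have D0 : 0 <= D by lra.
    have := mulr_ge0 D0 (sqr_ge0 delta); lra.
  apply: le_trans (gnp_prob_exists p01 _) _.
  rewrite -[n in leRHS]card_ord -cardsT -sum_subset_expr.
  rewrite [X in _ <= X - 1](bigD1 set0) ?sub0set //= cards0 expr0 [1 + _]addrC addrK.
  rewrite (bigD1 set0) //= [X in X + _]big1 ?add0r => [|G]; last first.
    by rewrite /B2 eqxx.
  rewrite [leRHS]big_mkcond [leLHS]big_mkcond /=; apply: ler_sum => S _.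
  rewrite subsetT /=; case: ifP => // S0.
  have [psd|npsd] := boolP (4 * (p * #|S|%:R) <= delta).
    apply: le_trans (expansion_tail d01 D1 psd).
    by apply: gnp_prob_mono => // G /and3P[].
  (* Above the size threshold the event [B2] is empty. *)
  rewrite [leLHS]big1 ?exprn_ge0 ?ltW // => G.
  by rewrite /B2 (negbTE npsd) andbF.
have na : n%:R * a <= n%:R^-1.
  apply: le_trans (ler_wpM2l (ltW n0) an) _.
  by rewrite expr2 invfM mulrA divff ?gt_eqF // mul1r.
have ni : n%:R^-1 <= 2^-1 :> R by rewrite lef_pV2 ?posrE // ler_nat.
have : (1 + a) ^+ n - 1 <= n%:R^-1 + 2 * n%:R^-1 ^+ 2.
  apply: le_trans (expR_le_quadratic _); last by rewrite ni invr_ge0 ltW.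
  rewrite lerD2r; apply: le_trans (expr_one_add_le _ _) _.
    by rewrite (le_trans (lerN10 R)) // ltW.
  by rewrite ler_expR.
move: na ni; have : 0 < n%:R^-1 :> R by rewrite invr_gt0.
by move: (n%:R^-1) (_ * a) (_ ^+ n) => u x y; nra.
Qed.

End Tails.

(** * Counting a symmetric difference *)

Section SymmetricDifference.
Import fintype boot.finset.

(** In fact an equality. It converts a large union of two balls of bounded size into a large
    symmetric difference. *)
Lemma card_setU_symdiff (T : finType) (X Y : {set T}) :
  (2 * #|X :|: Y| <= #|X| + #|Y| + #|[set u | (u \in X) != (u \in Y)]|)%N.
Proof.
have -> : [set u | (u \in X) != (u \in Y)] = (X :|: Y) :\: (X :&: Y).
  by apply/setP => u; rewrite !inE; case: (u \in X); case: (u \in Y).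
rewrite -cardsUI mul2n -addnn -addnA leq_add2l.
by rewrite -[leqLHS](cardsID (X :&: Y)) leq_add2r subset_leq_card ?subsetIr.
Qed.

End SymmetricDifference.

(** * Both bounds for a single graph with controlled degrees and expansion *)

Section FixedSize.
Import fintype boot.finset.
Variables (R : realType) (n : nat) (p delta kappa : R) (r : nat) (G : graph n).
Let D := n%:R * p.
Let Q := n%:R / D ^+ r.
Hypotheses (n_gt1 : (1 < n)%N) (p_gt0 : 0 < p) (r_gt0 : (0 < r)%N).
Hypotheses (D_ge1 : 1 <= D) (delta_01 : 0 <= delta <= 1).
Hypotheses (D_delta : D^-1 <= delta) (Q_delta : 16 / Q <= delta).
Hypotheses (delta_kappa : delta * r%:R <= kappa) (kappa_le : kappa <= 12^-1).
Hypothesis degG : forall v : 'I_n, #|nbrs (adj G) [set v]|%:R <= (1 + delta) * D.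
Hypothesis expG : forall S : {set 'I_n}, S != set0 ->
  4 * (p * #|S|%:R) <= delta ->
  (1 - delta) * D * #|S|%:R <= #|nbrs (adj G) S :\: S|%:R.

Let n_gt0 : 0 < n%:R :> R. Proof. by rewrite ltr0n ltnW. Qed.
Let D_gt0 : 0 < D. Proof. exact: lt_le_trans D_ge1. Qed.
Let Q_gt0 : 0 < Q. Proof. by rewrite divr_gt0 // exprn_gt0. Qed.
Let delta_ge0 : 0 <= delta. Proof. by case/andP: delta_01. Qed.
Let kappa_ge0 : 0 <= kappa.
Proof. by apply: le_trans delta_kappa; rewrite mulr_ge0. Qed.

(** The summand 1 is absorbed through [1 <= delta * D]; then [(1 + 2 delta)^k] is at most
    [expR (2 * kappa)], which is at most [1 + 4 kappa] as [kappa <= 1 / 12]. *)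
Let growth k : (k <= r)%N ->
  (1 + (1 + delta) * D) ^+ k <= (1 + 4 * kappa) * D ^+ k.
Proof.
move=> kr; apply: (@le_trans _ _ (((1 + 2 * delta) * D) ^+ k)).
  have D0 := ltW D_gt0; have dD0 := mulr_ge0 delta_ge0 D0.
  have : 1 <= delta * D by rewrite -ler_pdivrMr // mul1r.
  by move=> dD; apply: lerXn2r; rewrite ?nnegrE; lra.
rewrite exprMn ler_wpM2r ?exprn_ge0 ?(ltW D_gt0) //.
apply: le_trans (expr_one_add_le _ _) _.
  by apply: le_trans (lerN10 R) _; rewrite mulr_ge0.
have kk : k%:R * (2 * delta) <= 2 * kappa.
  have : delta * k%:R <= delta * r%:R by rewrite ler_wpM2l // ler_nat.
  by move: delta_kappa; lra.
have le1 : expR (k%:R * (2 * delta)) <= expR (2 * kappa) by rewrite ler_expR.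
have : expR (2 * kappa) - 1 <= 2 * kappa + 2 * (2 * kappa) ^+ 2.
  by apply: expR_le_quadratic; apply/andP; split; move: kappa_le kappa_ge0; lra.
have : kappa * kappa <= kappa * 12^-1 by rewrite ler_wpM2l.
by move: le1 kappa_ge0; lra.
Qed.

Let ball_le u s : (s <= r)%N ->
  #|gball (adj G) u s|%:R <= (1 + 4 * kappa) * D ^+ r.
Proof.
move=> sr; apply: le_trans (growth (leqnn r)).
apply: le_trans (card_gball_le u r degG).
by rewrite ler_nat subset_leq_card // gball_subset.
Qed.

(** Twice the union has size at least [4 (1 - kappa) D^r], and the two balls take away at most
    [2 (1 + 4 kappa) D^r]. *)
Let symdiff_ge x y : x != y ->
  2 * (1 - 6 * kappa) * D ^+ r <=
  #|[set u | (u \in gball (adj G) x r) != (u \in gball (adj G) y r)]|%:R.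
Proof.
move=> xy; have /andP[d0 d1] := delta_01.
set X := gball (adj G) x r; set Y := gball (adj G) y r; set Z := [set u | _].
have cU : 2 * ((1 - delta) * D) ^+ r <= #|X :|: Y|%:R.
  (* The threshold [4 D^(r-1)] exceeds [2 (1 + 4 kappa) D^(r-1)] and is still within reach of
     [expG], since [4 p] times it is [16 / Q]. *)
  apply: (@card_gballU_ge _ _ _ _ _ x y r (4 * D ^+ r.-1) xy _ degG).
  - by rewrite mulr_ge0 ?subr_ge0 // ltW.
  - have := growth (leq_pred r).
    have : 4 * kappa * D ^+ r.-1 <= 1 * D ^+ r.-1.
      by rewrite ler_wpM2r ?exprn_ge0 ?(ltW D_gt0) //; move: kappa_le; lra.
    lra.
  - move=> S S0 SD; apply: expG => //; apply: le_trans Q_delta.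
    have -> : 16 / Q = 4 * (p * (4 * D ^+ r.-1)).
      rewrite /Q; case: (r) r_gt0 => // k _ /=; rewrite exprS /D.
      by field; rewrite (gt_eqF p_gt0) (gt_eqF n_gt0) expf_neq0 // gt_eqF.
    by rewrite ler_wpM2l // ler_wpM2l // ltW.
have count : (2 * #|X :|: Y| <= #|X| + #|Y| + #|Z|)%N by exact: card_setU_symdiff.
have cX : #|X|%:R <= (1 + 4 * kappa) * D ^+ r by exact: ball_le.
have cY : #|Y|%:R <= (1 + 4 * kappa) * D ^+ r by exact: ball_le.
have : (1 - kappa) * D ^+ r <= ((1 - delta) * D) ^+ r.
  rewrite [((1 - delta) * D) ^+ r]exprMn ler_wpM2r ?exprn_ge0 ?(ltW D_gt0) //.
  by apply: le_trans (bernoulli_sub r delta_01); move: delta_kappa; lra.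
by move: count; rewrite -(ler_nat R) natrM !natrD; lra.
Qed.

(** The entropy bound at [q = 1 / Q], the approximate fraction of the vertices in a ball of radius
    [r]; the term [- ln (1 - q)] costs the relative error [2 / ln Q]. *)
Lemma Mle_graph_ge : 4 <= Q ->
  (1 - (4 * kappa + 2 / ln Q)) * (Q * (ln n%:R / ln Q)) <= (Mle (adj G) r)%:R.
Proof.
move=> Q4; have lnQ0 : 0 < ln Q by rewrite ln_gt0 //; lra.
have lnn0 : 0 <= ln n%:R :> R by rewrite ln_ge0 // ler1n ltnW.
have iQ : Q^-1 <= 4^-1 by rewrite lef_pV2 ?posrE.
have iQ0 : 0 < Q^-1 by rewrite invr_gt0.
have := @Mle_ge R _ (adj G) r ((1 + 4 * kappa) * D ^+ r) Q^-1.
rewrite card_ord lnV ?posrE // opprK.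
move=> /(_ (ltnW n_gt1)); rewrite iQ0 => /(_ _ ball_le) H.
have {H} : ln n%:R <= (Mle (adj G) r)%:R *
    ((1 + 4 * kappa) * D ^+ r / n%:R * ln Q - ln (1 - Q^-1)).
  by apply: H => /=; lra.
have -> : (1 + 4 * kappa) * D ^+ r / n%:R = (1 + 4 * kappa) / Q.
  by rewrite /Q; field; rewrite !gt_eqF // ?exprn_gt0.
set M : R := (Mle _ _)%:R; have M0 : 0 <= M by [].
(* [expR (- (2 / Q))] is at most [1 - 2 / Q + 4 / Q^2], and [4 / Q^2 <= 1 / Q] because [Q >= 4]. *)
have ln1 : - ln (1 - Q^-1) <= 2 / Q.
  rewrite lerNl -[leLHS]expRK ler_ln ?posrE ?expR_gt0 ?subr_gt0 //; last by lra.
  have /one_sub_expRN_ge : 0 <= 2 / Q by rewrite divr_ge0 // ltW.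
  have : Q^-1 * Q^-1 <= 4^-1 * Q^-1 by rewrite ler_wpM2r // ltW.
  by move: (expR _) => x; lra.
move=> le1.
have {le1} le1 : Q * (ln n%:R / ln Q) <= M * (1 + (4 * kappa + 2 / ln Q)).
  rewrite mulrA ler_pdivrMr // mulrC -ler_pdivlMr //.
  apply: le_trans le1 _.
  have -> : M * (1 + (4 * kappa + 2 / ln Q)) * ln Q / Q =
     M * ((1 + 4 * kappa) / Q * ln Q + 2 / Q).
    by field; rewrite !gt_eqF.
  by rewrite ler_wpM2l // lerD2l.
set a := 4 * kappa + _ in le1 *; set X := Q * _ in le1 *.
have X0 : 0 <= X by rewrite mulr_ge0 ?(ltW Q_gt0) // divr_ge0 // ltW.
(* For [a >= 1] the bound is trivial; otherwise [(1 - a) (1 + a) <= 1] inverts the factor. *)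
have [a1|a1] := leP 1 a.
  by apply: le_trans M0; rewrite mulr_le0_ge0 // subr_le0.
have a1' : 0 <= 1 - a by rewrite subr_ge0 ltW.
apply: le_trans (ler_wpM2l a1' le1) _.
have := mulr_ge0 M0 (sqr_ge0 a); lra.
Qed.

(** The number [x] of centres brings the expected count of unseparated pairs below 1. Since
    [kappa <= 1 / 12], [1 / (1 - 6 kappa)] is at most [1 + 12 kappa]; rounding [x] up accounts for
    the term [(Q * ln n)^-1]. *)
Lemma Mle_graph_le :
  (Mle (adj G) r)%:R <= (1 + (12 * kappa + (Q * ln n%:R)^-1)) * (Q * ln n%:R).
Proof.
have lnn0 : 0 < ln n%:R :> R by rewrite ln_gt0 // ltr1n.
have k6 : 0 < 1 - 6 * kappa by move: kappa_le; lra.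
pose x := Q * ln n%:R / (1 - 6 * kappa); pose m := (Num.truncn x).+1.
have x0 : 0 <= x by apply: divr_ge0; [apply: mulr_ge0|]; exact: ltW.
have xm : x <= m%:R by rewrite ltW // truncnS_gt.
have mx : m%:R <= x + 1 by rewrite -natr1 lerD2r truncn_le.
have Mm : (Mle (adj G) r <= m)%N.
  apply: (@Mle_le R _ _ _ _ (2 * (1 - 6 * kappa) * D ^+ r)) => //.
    exact: adj_sym.
    by rewrite card_ord ltnW.
  rewrite card_ord -{1}[n%:R]lnK ?posrE // -expRM_natl -expRD -[leRHS]expR0 ler_expR.
  have : x * (1 - 6 * kappa) <= m%:R * (1 - 6 * kappa) by rewrite ler_pM2r.
  rewrite /x divfK ?gt_eqF // mulrC -ler_pdivlMr // => le1.
  have -> : m%:R * (2 * (1 - 6 * kappa) * D ^+ r) / n%:R =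
      2 * (m%:R * (1 - 6 * kappa) / Q).
    by rewrite /Q; field; rewrite !gt_eqF // ?exprn_gt0.
  lra.
apply: (@le_trans _ _ m%:R); first by rewrite ler_nat.
apply: le_trans mx _.
have QL : 0 < Q * ln n%:R by rewrite mulr_gt0.
rewrite addrA mulrDl mulVf ?gt_eqF // lerD2r /x.
rewrite ler_pdivrMr // [leRHS]mulrAC ler_peMl ?(ltW QL) //.
have : kappa * kappa <= kappa * 12^-1 by rewrite ler_wpM2l.
lra.
Qed.

End FixedSize.

Local Open Scope classical_set_scope.
Local Open Scope ring_scope.

(** * Growth of the parameters with [n] *)

Section Asymptotics.
Variable R : realType.
Implicit Types (n d r : nat) (p K x : R).

Lemma ln2_itv : 0 < (ln 2 : R) <= 1.
Proof.
rewrite ln_gt0 ?ltr1n //= -[leRHS]expRK ler_ln ?posrE ?expR_gt0 //.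
by have := expR_ge1Dx (1 : R); lra.
Qed.

Lemma ln_le_log2 x : 1 <= x -> ln x <= log2 x.
Proof.
have /andP[l0 l1] := ln2_itv => x1.
by rewrite /log2 ler_pdivlMr // ler_piMr // ln_ge0.
Qed.

Lemma log2_natr_dvg K : \forall n \near \oo, K <= log2 (n%:R : R).
Proof.
have := nbhs_infty_ger (expR K); apply: filterS2 (nbhs_infty_ge 1%N) => n n1 Kn.
have n0 : (1 : R) <= n%:R by rewrite ler1n.
apply: le_trans (ln_le_log2 n0).
by rewrite -[leLHS]expRK ler_ln ?posrE ?expR_gt0 // (lt_le_trans ltr01).
Qed.

(** The bound on [p^d n^(d-1)] gives [n <= (n p)^d], so [ln (n p)] is at least [ln n / d], which
    exceeds [3 ln (log2 n)] by at least [ln K]. *)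
Lemma average_degree_ge n d p K : (0 < n)%N -> (0 < d)%N -> 0 < p -> 0 < K ->
    1 <= log2 (n%:R : R) -> 1 <= p ^+ d * n%:R ^+ (d - 1) ->
    log2 K <= log2 n%:R / d%:R - 3 * log2 (log2 n%:R) ->
  K * log2 n%:R ^+ 3 <= n%:R * p.
Proof.
have /andP[l0 _] := ln2_itv => n0 d0 p0 K0 L1 pd Kd.
have n0' : 0 < n%:R :> R by rewrite ltr0n.
have d0' : 0 < d%:R :> R by rewrite ltr0n.
have L0 := lt_le_trans ltr01 L1.
have L30 := exprn_gt0 3 L0; have D0 := mulr_gt0 n0' p0.
rewrite -ler_ln ?posrE // ?(mulr_gt0 K0) // lnM ?posrE // lnXn //.
have lnn : ln n%:R <= d%:R * ln (n%:R * p).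
  rewrite mulr_natl -lnXn // ler_ln ?posrE ?exprn_gt0 //.
  have -> : (n%:R * p) ^+ d = n%:R * (p ^+ d * n%:R ^+ (d - 1)).
    by case: (d) d0 => // k _; rewrite exprMn [in LHS]exprS subn1 /=; ring.
  by rewrite ler_peMr // ltW.
have : log2 K * ln 2 <= (log2 n%:R / d%:R - 3 * log2 (log2 n%:R)) * ln 2.
  by rewrite ler_pM2r.
have log2K x : log2 x * ln 2 = ln x by rewrite /log2 divfK ?gt_eqF.
rewrite mulrBl [log2 n%:R / _ * _]mulrAC -[3 * _ * _]mulrA !log2K.
have : ln n%:R / d%:R <= ln (n%:R * p) by rewrite ler_pdivrMr // mulrC.
by rewrite -mulr_natr; lra.
Qed.

(** Since [r + 1 <= d - 1], [(n p)^(r+1)] is at most [(n p)^(d-1) = n (p^(d-1) n^(d-2))], hence at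
    most [n x]. *)
Lemma ball_fraction_ge n d r p x : (0 < n)%N -> (r <= d - 2)%N -> (2 < d)%N ->
    0 < p -> 1 <= n%:R * p -> 0 < x ->
    p ^+ (d - 1) * n%:R ^+ (d - 2) <= x ->
  n%:R * p / x <= n%:R / (n%:R * p) ^+ r.
Proof.
move=> n0 rd d2 p0 D1 x0 px; have n0' : 0 < n%:R :> R by rewrite ltr0n.
have D0 := lt_le_trans ltr01 D1.
rewrite ler_pdivrMr // mulrAC ler_pdivlMr ?exprn_gt0 // -exprS.
apply: (@le_trans _ _ ((n%:R * p) ^+ (d - 1))).
  by apply: ler_weXn2l => //; lia.
have -> : (n%:R * p) ^+ (d - 1) = n%:R * (p ^+ (d - 1) * n%:R ^+ (d - 2)).
  by rewrite exprMn mulrCA -exprS (_ : (d - 2).+1 = (d - 1)%N) 1?mulrC //; lia.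
by rewrite ler_pM2l.
Qed.

Lemma ball_fractionE n r p : (0 < n)%N -> 0 < p ->
  n%:R ^ (1 - r%:Z) * p ^ (- r%:Z) = n%:R / (n%:R * p) ^+ r.
Proof.
move=> n0 p0; have n0' : n%:R != 0 :> R by rewrite pnatr_eq0 -lt0n.
by rewrite expfzDr // expr1z -!exprnN exprMn invfM mulrA.
Qed.

Lemma cvg0_le (f : nat -> R) :
    (forall e, 0 < e -> \forall n \near \oo, 0 <= f n <= e) ->
  f n @[n --> \oo] --> (0 : R).
Proof.
move=> fe; apply/cvgr0Pnorm_le => e e0.
by apply: filterS (fe e e0) => n /andP[f0 fle]; rewrite ger0_norm.
Qed.

End Asymptotics.

Theorem theorem3p6 (R : realType) (d : nat -> nat) (p : nat -> R)
  (d_ge3 : forall n, (3 <= d n)%N)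
  (p_01 : forall n, 0 < p n < 1)
  (hd : (log2 n%:R / (d n)%:R - 3 * log2 (log2 n%:R) : R) @[n --> \oo] --> +oo)
  (hp_lo : (p n ^+ d n * n%:R ^+ (d n - 1) - 2 * log2 n%:R) @[n --> \oo]
             --> +oo)
  (hp_hi : (p n ^+ (d n - 1) * n%:R ^+ (d n - 2) - 2 * log2 n%:R) @[n --> \oo]
             --> -oo)
  (r : nat -> nat) (hr : forall n, (1 <= r n <= d n - 2)%N) :
  let Q n : R := n%:R ^ (1 - (r n)%:Z) * p n ^ (- (r n)%:Z) in
  exists eps1 eps2 : nat -> R,
    [/\ eps1 n @[n --> \oo] --> (0 : R), eps2 n @[n --> \oo] --> (0 : R) &
     gnp_prob (p n) (fun G : graph n =>
       (1 - eps1 n) * (Q n * (log2 n%:R / log2 (Q n)))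
         <= (Mle (adj G) (r n))%:R
         <= (1 + eps2 n) * (Q n * ln n%:R)) @[n --> \oo]
         --> (1 : R)].
Proof.
move=> Q.
pose L n : R := log2 n%:R; pose D n := n%:R * p n.
(* The constant 32 makes [D delta^2 / 16] equal to [2 L], as the union bounds require; [kappa]
   dominates [delta r] because eventually [r <= d <= L]. *)
pose delta n := Num.sqrt (32 * L n / D n); pose kappa n := delta n * L n.
have p0 n : 0 < p n by case/andP: (p_01 n).
have n_large := nbhs_infty_ge 2%N.
have L_large K : \forall n \near \oo, K <= L n by exact: log2_natr_dvg.
have D_large K : 0 < K -> \forall n \near \oo, K * L n ^+ 3 <= D n.
  move=> K0; near=> n; apply: (average_degree_ge (d := d n)) => //.
  - by near: n; exact: nbhs_infty_ge 1%N.
  - exact: leq_trans (d_ge3 n).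
  - by near: n; exact: L_large.
  - have : 1 <= L n by near: n; exact: L_large.
    have : 0 <= p n ^+ d n * n%:R ^+ (d n - 1) - 2 * log2 n%:R.
      by near: n; move/cvgryPge : hp_lo; apply.
    by rewrite /L; lra.
  - by near: n; move/cvgryPge : hd; apply.
(* By [hp_hi], eventually [x = 2 * L n] is admissible in [ball_fraction_ge]. *)
have Q_ge : \forall n \near \oo, D n / (2 * L n) <= Q n.
  near=> n.
  have n2 : (1 < n)%N by near: n.
  have L1 : 1 <= L n by near: n; exact: L_large.
  have D1 : 1 * L n ^+ 3 <= D n by near: n; exact: D_large.
  have L3 : 1 <= L n ^+ 3 by rewrite exprn_ege1.
  have /andP[r1 rd] := hr n.
  rewrite /Q ball_fractionE ?(ltnW n2) //.
  apply: (ball_fraction_ge (d := d n)) => //.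
  - exact: ltnW.
  - by rewrite mul1r in D1; exact: le_trans D1.
  - lra.
  - rewrite -subr_le0; near: n; by move/cvgrNyPle : hp_hi; apply.
have Q_large K : 0 < K -> \forall n \near \oo, K <= Q n.
  move=> K0; near=> n.
  have L1 : 1 <= L n by near: n; exact: L_large.
  have DK : 2 * K * L n ^+ 3 <= D n by near: n; apply: D_large; rewrite mulr_gt0.
  have : D n / (2 * L n) <= Q n by near: n.
  apply: le_trans; rewrite ler_pdivlMr; last by lra.
  apply: le_trans DK; rewrite mulrCA mulrA ler_pM2l ?mulr_gt0 //.
  by rewrite -[leLHS]expr1 ler_weXn2l.
(* [kappa^2] is [32 L^3 / D], so the cubic growth in [D_large] is what is needed. *)
have kappa_small e : 0 < e -> \forall n \near \oo, 0 <= kappa n <= e.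
  move=> e0; near=> n.
  have L1 : 1 <= L n by near: n; exact: L_large.
  have L0 := lt_le_trans ltr01 L1.
  have De : 32 / e ^+ 2 * L n ^+ 3 <= D n.
    by near: n; apply: D_large; rewrite divr_gt0 ?exprn_gt0.
  have D0 : 0 < D n by apply: lt_le_trans De; rewrite mulr_gt0 ?divr_gt0 ?exprn_gt0.
  rewrite /kappa mulr_ge0 ?sqrtr_ge0 ?(ltW L0) //= -ler_pdivlMr //.
  have eL : 0 <= e / L n by rewrite ltW // divr_gt0.
  rewrite -(ger0_norm eL) -sqrtr_sqr ler_wsqrtr //.
  rewrite ler_pdivrMr //.
  have -> : 32 * L n = (e / L n) ^+ 2 * (32 / e ^+ 2 * L n ^+ 3).
    by field; rewrite !gt_eqF.
  by rewrite ler_wpM2l ?sqr_ge0.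
(* The two error terms are those of [Mle_graph_ge] and [Mle_graph_le]. *)
exists (fun n => 4 * kappa n + 2 / ln (Q n)).
exists (fun n => 12 * kappa n + (Q n * ln n%:R)^-1); split.
- apply: cvg0_le => e e0; near=> n.
  have : 0 <= kappa n <= e / 8 by near: n; apply: kappa_small; rewrite divr_gt0.
  have QK : expR (4 / e) <= Q n by near: n; apply: Q_large; exact: expR_gt0.
  have lnQ : 4 / e <= ln (Q n).
    by rewrite -[leLHS]expRK ler_ln ?posrE ?expR_gt0 // (lt_le_trans _ QK) ?expR_gt0.
  have e4 : 0 < 4 / e by rewrite divr_gt0.
  have : 0 <= (ln (Q n))^-1 <= e / 4.
    rewrite invr_ge0 (le_trans (ltW e4)) //= -[leRHS]invf_div lef_pV2 ?posrE //.
    exact: lt_le_trans lnQ.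
  lra.
- apply: cvg0_le => e e0; near=> n.
  have : 0 <= kappa n <= e / 24 by near: n; apply: kappa_small; rewrite divr_gt0.
  have QK : 2 / e <= Q n by near: n; apply: Q_large; rewrite divr_gt0.
  have ln1 : 1 <= ln n%:R :> R.
    rewrite -[leLHS]expRK ler_ln ?posrE ?expR_gt0 //.
      by near: n; exact: nbhs_infty_ger.
    by rewrite ltr0n ltnW //; near: n.
  have e2 : 0 < 2 / e by rewrite divr_gt0.
  have Ql : 2 / e <= Q n * ln n%:R.
    by apply: (le_trans QK); rewrite ler_peMr // (le_trans _ QK) // ltW.
  have : 0 <= (Q n * ln n%:R)^-1 <= e / 2.
    rewrite invr_ge0 (le_trans (ltW e2)) //= -[leRHS]invf_div lef_pV2 ?posrE //.
    exact: lt_le_trans Ql.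
  lra.
apply/cvgrPdist_le => e e0; near=> n.
have n2 : (1 < n)%N by near: n.
have n0 : 0 < n%:R :> R by rewrite ltr0n ltnW.
have p01 : 0 <= p n <= 1 by case/andP: (p_01 n) => ? ?; rewrite !ltW.
rewrite ger0_norm ?subr_ge0 ?gnp_prob_le1 //.
have n4 : 4 / n%:R <= e.
  by rewrite ler_pdivrMr // mulrC -ler_pdivrMr //; near: n; exact: nbhs_infty_ger.
suff : 1 - 4 / n%:R <= gnp_prob (p n) (fun G : graph n =>
       (1 - (4 * kappa n + 2 / ln (Q n))) * (Q n * (log2 n%:R / log2 (Q n)))
         <= (Mle (adj G) (r n))%:R
         <= (1 + (12 * kappa n + (Q n * ln n%:R)^-1)) * (Q n * ln n%:R)) by lra.
have L1 : 1 <= L n by near: n; exact: L_large.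
have L0 := lt_le_trans ltr01 L1.
have L3 : L n <= L n ^+ 3 by rewrite -[leLHS]expr1 ler_weXn2l.
have D32 : 32 * L n <= D n.
  apply: (@le_trans _ _ (32 * L n ^+ 3)); first by rewrite ler_pM2l.
  by near: n; exact: D_large.
have D1 : 1 <= D n by lra.
have D0 : 0 < D n by lra.
have delta2 : delta n ^+ 2 = 32 * L n / D n.
  by rewrite sqr_sqrtr // ltW // divr_gt0 // mulr_gt0.
have delta0 : 0 <= delta n by exact: sqrtr_ge0.
have delta1 : delta n <= 1.
  by rewrite -(@ler_pXn2r _ 2) ?nnegrE // expr1n delta2 ler_pdivrMr // mul1r.
have QD : D n / (2 * L n) <= Q n by near: n.
have Q4 : 4 <= Q n by near: n; exact: Q_large.
have QE : Q n = n%:R / D n ^+ r n by rewrite /Q ball_fractionE // ltnW.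
have /andP[r1 rd] := hr n.
(* By [hd], eventually [L / d] is at least 1 plus a nonnegative iterated logarithm. *)
have dL : (d n)%:R <= L n.
  have d0 : 0 < (d n)%:R :> R by rewrite ltr0n (leq_trans _ (d_ge3 n)).
  have : 1 <= log2 (n%:R : R) / (d n)%:R - 3 * log2 (log2 n%:R).
    by near: n; move/cvgryPge : hd; apply.
  have : 0 <= log2 (log2 n%:R : R).
    by apply: le_trans (ln_le_log2 L1); exact: ln_ge0.
  rewrite -/(L n) => ? ?; have : 1 <= L n / (d n)%:R by lra.
  by rewrite ler_pdivlMr // mul1r.
have delta_le : delta n ^+ 2 <= delta n by rewrite expr2 ler_piMl.
apply: le_trans (degree_expansion_whp p01 n2 _ D1 (delta := delta n) _) _.
- by rewrite delta0.
- have -> : D n * delta n ^+ 2 / 16 = 2 * L n.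
    by rewrite delta2; field; rewrite gt_eqF.
  by rewrite ler_pM2l // ln_le_log2 // ler1n ltnW.
apply: gnp_prob_mono => // G /andP[/forallP degG /forallP expG].
have logE : log2 n%:R / log2 (Q n) = ln n%:R / ln (Q n) :> R.
  have /andP[l0 _] := ln2_itv R.
  have lQ0 : 0 < ln (Q n) by rewrite ln_gt0 //; lra.
  by rewrite /log2; field; rewrite !gt_eqF.
have D_delta : (D n)^-1 <= delta n.
  apply: le_trans delta_le; rewrite delta2 ler_peMl ?invr_ge0 ?(ltW D0) //; lra.
(* [delta^2] is exactly 16 divided by the lower bound [D / (2 L)] on [Q]. *)
have Q_delta : 16 / (n%:R / D n ^+ r n) <= delta n.
  rewrite -QE; apply: le_trans delta_le.
  have DL : 0 < D n / (2 * L n) by rewrite divr_gt0 // mulr_gt0.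
  have -> : delta n ^+ 2 = 16 / (D n / (2 * L n)).
    by rewrite delta2; field; rewrite !gt_eqF.
  by rewrite ler_pM2l // lef_pV2 ?posrE //; lra.
have delta_kappa : delta n * (r n)%:R <= kappa n.
  rewrite ler_wpM2l //; apply: le_trans dL.
  by rewrite ler_nat (leq_trans rd) // leq_subr.
have kappa_le : kappa n <= 12^-1.
  suff /andP[] : 0 <= kappa n <= 12^-1 by [].
  by near: n; apply: kappa_small; rewrite invr_gt0.
have degG' v : #|nbrs (adj G) [set v]%SET|%:R <= (1 + delta n) * D n.
  exact: ltW (degG v).
have expG' S : S != finset.set0 -> 4 * (p n * #|S|%:R) <= delta n ->
    (1 - delta n) * D n * #|S|%:R <= #|nbrs (adj G) S :\: S|%:R.
  by move=> S0 pS; have /implyP/(_ S0)/implyP/(_ pS) := expG S.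
have delta01 : 0 <= delta n <= 1 by rewrite delta0.
rewrite logE QE; apply/andP; split.
  by apply: (Mle_graph_ge (delta := delta n)) => //; rewrite -QE.
by apply: (Mle_graph_le (delta := delta n)).
Unshelve. all: by end_near.
Qed.
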